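(* Let $P(G;X)=\sum_{i=0}^{d(G)}h_i(G)X^i$ be a univariate graph polynomial with integer coefficients, and such that $|h_i(G)|\le|V(G)|^r$ for some fixed $r\in\mathbb{N}$. Then there exists a univariate graph polynomial $P_1(G;X)$ which is substitution equivalent to $P(G;X)$ such that all complex roots $\xi$ of $P_1(G;X)$ satisfy $|\xi|\le 2$.
   Context: A (finite) graph $G=(V(G),E(G))$ is given by its set of vertices $V(G)$ and a symmetric edge relation $E(G)$. A univariate graph polynomial is a graph invariant with values in a polynomial ring in one indeterminate $X$, of the form $\sum_{i=0}^{d(G)}h_i(G)X^i$, where $d(G)$ is a graph parameter with non-negative integer values and the coefficients $h_i(G)$, $i\le d(G)$, are graph parameters (here integer valued). The bound $|h_i(G)|\le|V(G)|^r$ is for all graphs $G$ and all $i$, with the same $r$. A complex number $\xi$ is a root of a univariate graph polynomial $P_1(G;X)$ if there is a graph $G$ with $P_1(G;\xi)=0$. Two graphs are similar if they have the same number of vertices, the same number of edges and the same number of connected components. A similarity function is a graph parameter $g(G)$ with values in some function space over some ring such that $g(G)=g(H)$ whenever $G$ and $H$ are similar; when its values are functions of an indeterminate $X$ it is written $g(G;X)$ (examples are polynomials, rational functions or analytic functions in $X$ depending only on the similarity class of $G$). For univariate graph polynomials, $P(G;X)$ is substitution reducible to $Q(G;X)$ (over a given set of similarity functions) if there is a similarity function $g(G;X)$ in that set such that $P(G;X)=Q(G;g(G;X))$ for all graphs $G$. $P$ and $Q$ are substitution equivalent if each is substitution reducible to the other.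
   Formalization: Roots of P_1 are taken only over graphs G for which P_1(G;X) is not the zero polynomial (otherwise P = 0 is a counterexample); the set of similarity functions is any set containing those that are polynomials in X over the rationals. *)

(* Defs.v *)
From HB Require Import structures.
From mathcomp Require Import all_boot all_order all_algebra.
From mathcomp Require Import reals complex.

Set Implicit Arguments.
Unset Strict Implicit.
Unset Printing Implicit Defensive.

Import Order.TTheory GRing.Theory Num.Theory.
Local Open Scope ring_scope.

(* Only symmetry is required of the edge relation: loops and the graph without
   vertices are allowed. *)
Record graph := Graph {
  vertex :> finType;
  edge : rel vertex;
  edge_sym : symmetric edge }.

Definition graph_iso (G H : graph) : Prop :=
  exists2 f : G -> H, bijective f & forall x y, edge (f x) (f y) = edge x y.

Definition nb_vertices (G : graph) : nat := #|G|.

(* An edge is the set of its end points, so that a loop counts once. *)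
Definition edges (G : graph) : {set {set G}} :=
  [set [set p.1; p.2] | p : G * G & edge p.1 p.2].

Definition nb_edges (G : graph) : nat := #|edges G|.

Definition nb_components (G : graph) : nat := n_comp (@edge G) (@predT G).

Definition similar (G H : graph) : Prop :=
  [/\ nb_vertices G = nb_vertices H,
      nb_edges G = nb_edges H &
      nb_components G = nb_components H].

(* [gp_bound] is d and [gp_coef G i] is h_i(G); the values of h_i(G) for
   i > d(G) are irrelevant, hence unconstrained. As h_{d(G)}(G) may vanish,
   d(G) is only an upper bound for the degree. *)
Record graph_polynomial := GraphPolynomial {
  gp_bound : graph -> nat;
  gp_coef : graph -> nat -> int;
  gp_bound_iso : forall G H, graph_iso G H -> gp_bound G = gp_bound H;
  gp_coef_iso : forall G H, graph_iso G H ->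
    forall i, (i <= gp_bound G)%N -> gp_coef G i = gp_coef H i }.

Definition gp_poly (P : graph_polynomial) (G : graph) : {poly int} :=
  \poly_(i < (gp_bound P G).+1) gp_coef P G i.

Section Substitution.

Variable R : realType.

Definition gp_eval (P : graph_polynomial) (G : graph) (x : R[i]) : R[i] :=
  (map_poly intr (gp_poly P G)).[x].

(* Graphs at which the polynomial is identically zero contribute no roots:
   otherwise every complex number would be a root as soon as P(G; X) = 0 for a
   single graph G. *)
Definition gp_root (P : graph_polynomial) (x : R[i]) : Prop :=
  exists2 G : graph, gp_poly P G != 0 & gp_eval P G x = 0.

Definition similarity_function (g : graph -> R[i] -> R[i]) : Prop :=
  forall G H, similar G H -> g G = g H.

Definition rat_polynomial_valued (g : graph -> R[i] -> R[i]) : Prop :=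
  forall G, exists q : {poly rat}, forall x, g G x = (map_poly ratr q).[x].

(* [S] is the given set of admissible similarity functions. *)
Definition subst_reducible (S : (graph -> R[i] -> R[i]) -> Prop)
    (P Q : graph_polynomial) : Prop :=
  exists g : graph -> R[i] -> R[i],
    [/\ S g, similarity_function g &
        forall G x, gp_eval P G x = gp_eval Q G (g G x)].

Definition subst_equivalent (S : (graph -> R[i] -> R[i]) -> Prop)
    (P Q : graph_polynomial) : Prop :=
  subst_reducible S P Q /\ subst_reducible S Q P.

End Substitution.

(* Main.v *)
(** The witness is [P1(G; X) = P(G; N X)] with [N = max(1, |V(G)|^r)]; the inverse
    substitution is [X / N], and both are similarity functions because [N] only
    depends on the number of vertices (the maximum avoids [N = 0] for the graph
    without vertices). By Cauchy's bound, and since a nonzero integer leading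
    coefficient has absolute value at least 1, the roots [z] of [P(G; X)] satisfy
    [|z| <= 1 + N], hence those of [P1(G; X)] have modulus at most
    [(1 + N) / N <= 2]. *)
Require Import Defs.
From HB Require Import structures.
From mathcomp Require Import all_boot all_order all_algebra.
From mathcomp Require Import reals complex.
Import Order.TTheory GRing.Theory Num.Theory.
Local Open Scope ring_scope.

(** If [|z| > 1 + M], isolating the leading term gives [|z|^d <= M * s] with [s] the sum of [|z|^i]
    for [i < d], while [M * s <= (|z| - 1) * s = |z|^d - 1], a contradiction. *)
Lemma cauchy_root_bound (F : numFieldType) (p : {poly F}) (M z : F) :
  1 <= `|lead_coef p| -> (forall i, `|p`_i| <= M) -> root p z ->
  `|z| <= 1 + M.
Proof.
move=> lead_ge1 coef_le /rootP pz0.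
have M_ge0 : 0 <= M by exact: le_trans (normr_ge0 _) (coef_le 0%N).
have p_neq0 : p != 0.
  by apply: contraTneq lead_ge1 => ->; rewrite lead_coef0 normr0 ler10.
(* The order of [F] is partial; both sides are real, hence comparable. *)
rewrite real_leNgt ?normr_real ?rpredD ?rpred1 ?ger0_real //.
apply/negP => z_gt.
move: pz0 lead_ge1; rewrite lead_coefE horner_coef.
case: (size p) (size_poly_gt0 p) => [|d _]; first by rewrite p_neq0.
rewrite big_ord_recr /= => /eqP; rewrite addrC addr_eq0 => /eqP lead_eq lead_ge1.
pose s := \sum_(i < d) `|z| ^+ i.
have s_ge0 : 0 <= s by apply: sumr_ge0 => i _; rewrite exprn_ge0.
have zd_le : `|z| ^+ d <= M * s.
  have := congr1 Num.norm lead_eq; rewrite normrN normrM normrX => normE.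
  apply: le_trans (_ : `|p`_d| * `|z| ^+ d <= _).
    by rewrite ler_peMl ?exprn_ge0.
  rewrite normE mulr_sumr; apply: le_trans (ler_norm_sum _ _ _) _.
  by apply: ler_sum => i _; rewrite normrM normrX ler_wpM2r ?exprn_ge0.
have : M * s <= `|z| ^+ d - 1.
  by rewrite subrX1 ler_wpM2r // lerBrDl ltW.
move=> /(le_trans zd_le); rewrite -subr_ge0 addrAC subrr add0r.
by rewrite oppr_ge0 ler10.
Qed.

Lemma graph_iso_nb_vertices (G H : graph) :
  graph_iso G H -> nb_vertices G = nb_vertices H.
Proof. by case=> f /bij_eq_card. Qed.

Definition gp_rescale (P : graph_polynomial) (c : nat -> nat) :
  graph_polynomial.
Proof.
refine (@GraphPolynomial (gp_bound P)
  (fun G i => gp_coef P G i * (c (nb_vertices G))%:Z ^+ i) (@gp_bound_iso P) _).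
abstract (by move=> G H isoGH i le_i;
  rewrite (gp_coef_iso isoGH le_i) (graph_iso_nb_vertices _ _ isoGH)).
Defined.

Lemma gp_poly_rescale (P : graph_polynomial) (c : nat -> nat) (G : graph)
    (i : nat) :
  (gp_poly (gp_rescale P c) G)`_i
    = (gp_poly P G)`_i * (c (nb_vertices G))%:Z ^+ i.
Proof. by rewrite !coef_poly /=; case: ifP => // _; rewrite mul0r. Qed.

(** Summing up to [gp_bound] rather than to the degree gives [P] and its rescaling the same index
    range, even where [c] vanishes and the degree drops. *)
Lemma gp_evalE (R : realType) (P : graph_polynomial) (G : graph) (x : R[i]) :
  gp_eval P G x
    = \sum_(i < (gp_bound P G).+1) ((gp_poly P G)`_i)%:~R * x ^+ i.
Proof.
rewrite /gp_eval (@horner_coef_wide _ (gp_bound P G).+1).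
  by apply: eq_bigr => i _; rewrite coef_map.
exact: leq_trans (size_poly _ _) (size_poly _ _).
Qed.

Lemma gp_eval_rescale (R : realType) (P : graph_polynomial) (c : nat -> nat)
    (G : graph) (x : R[i]) :
  gp_eval (gp_rescale P c) G x = gp_eval P G ((c (nb_vertices G))%:R * x).
Proof.
rewrite !gp_evalE; apply: eq_bigr => i _.
by rewrite gp_poly_rescale exprMn rmorphM rmorphXn /= mulrA.
Qed.

Lemma gp_eval_root_bound (R : realType) (P : graph_polynomial) (G : graph)
    (M : nat) (z : R[i]) :
  (forall i : nat, (i <= gp_bound P G)%N -> `|gp_coef P G i| <= M%:Z) ->
  gp_poly P G != 0 -> gp_eval P G z = 0 -> `|z| <= 1 + M%:R.
Proof.
move=> coef_le p_neq0 pz0.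
apply: (@cauchy_root_bound _ (map_poly intr (gp_poly P G))); last exact/rootP.
  rewrite lead_coef_map_inj ?rmorph0 //; last exact: intr_inj.
  by rewrite -intr_norm ler1z -gtz0_ge1 normr_gt0 lead_coef_eq0.
move=> i; rewrite coef_map coef_poly /= -intr_norm -[M%:R]/(M%:Z%:~R) ler_int.
by case: ifP => [|_]; [exact: coef_le | rewrite normr0].
Qed.

(** Serves both substitutions, by [N] and by [1 / N]; the latter is why the factor is rational. *)
Lemma scaling_admissible (R : realType) (S : (graph -> R[i] -> R[i]) -> Prop)
    (a : nat -> rat) :
  (forall g : graph -> R[i] -> R[i],
     similarity_function g -> rat_polynomial_valued g -> S g) ->
  let g G x := ratr (a (nb_vertices G)) * x in
  S g /\ similarity_function g.
Proof.
move=> hS g; have simg : similarity_function g.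
  by move=> G H [eqV _ _]; rewrite /g eqV.
split=> //; apply: hS => // G; exists ((a (nb_vertices G))%:P * 'X) => x.
by rewrite rmorphM /= map_polyC map_polyX hornerM hornerC hornerX.
Qed.

(* The admissible set [S] of similarity functions is arbitrary, as long as it
   contains the similarity functions that are polynomials in X over the
   rationals. *)
Theorem theorem4p26 (R : realType) (S : (graph -> R[i] -> R[i]) -> Prop)
  (hS : forall g : graph -> R[i] -> R[i],
     similarity_function g -> rat_polynomial_valued g -> S g)
  (P : graph_polynomial) (r : nat)
  (hP : forall (G : graph) (i : nat), (i <= gp_bound P G)%N ->
     `|gp_coef P G i| <= ((nb_vertices G) ^ r)%:Z) :
  exists P1 : graph_polynomial,
    subst_equivalent S P1 P /\
    forall xi : R[i], gp_root P1 xi -> `|xi| <= 2.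
Proof.
pose c n := maxn 1 (n ^ r).
have c_gt0 n : (0 < c n)%N by rewrite leq_maxl.
exists (gp_rescale P c); split; first split.
- have [Sg simg] := scaling_admissible _ _ (fun n => (c n)%:R) hS.
  by eexists; split; [exact: Sg | exact: simg | move=> G x /=];
    rewrite gp_eval_rescale ratr_nat.
- have [Sg simg] := scaling_admissible _ _ (fun n => (c n)%:R^-1) hS.
  eexists; split; [exact: Sg | exact: simg | move=> G x /=].
  by rewrite gp_eval_rescale fmorphV /= ratr_nat mulVKf ?pnatr_eq0 -?lt0n.
move=> xi [G p1_neq0]; rewrite gp_eval_rescale => root_cxi.
(* The root bound will be applied to [P] at [c n * xi], since the coefficient bound is known for [P]
   itself; nonvanishing must therefore be carried back to [P]. *)
have p_neq0 : gp_poly P G != 0.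
  apply: contraNneq p1_neq0 => p0; apply/eqP/polyP => i.
  by rewrite gp_poly_rescale p0 !coef0 mul0r.
set n := nb_vertices G in root_cxi.
have coef_le i : (i <= gp_bound P G)%N -> `|gp_coef P G i| <= (c n)%:Z.
  by move=> /hP /le_trans; apply; rewrite lez_nat leq_maxr.
have := gp_eval_root_bound _ _ _ _ _ coef_le p_neq0 root_cxi.
rewrite normrM normr_nat => cxi_le.
have c_pos : 0 < (c n)%:R :> R[i] by rewrite ltr0n.
rewrite -(ler_pM2l c_pos); apply: le_trans cxi_le _.
by rewrite mulr_natr mulr2n lerD2r ler1n.
Qed.
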